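(* If $S\subseteq GDN(X)$ is a non-empty set with $|S|<\infty$ and $S$ is homogeneous, then $GDN(X|S)=GDN(X)/Id(S)$ has a solvable word problem; that is, there is an algorithm which, given $f\in GDN(X)$, decides whether $f\in Id(S)$.
   Context: Let $k$ be a field of characteristic $0$ and $X$ a well-ordered set. $k\{X\}$ is the commutative polynomial algebra over $k$ in the letters $a[i]$ ($a\in X$, $i\ge -1$), with the $k$-linear derivation $D$ given by $D(a[i])=a[i+1]$, $D(1)=0$. $[D^{\omega}X]$ is the free commutative monoid on these letters, a $k$-basis of $k\{X\}$. For $w=a_n[i_n]\cdots a_1[i_1]$ put $|w|=n$ and $wt(w)=i_1+\dots+i_n$. $GDN(X)$ is the span of $\{w\in[D^\omega X]\mid wt(w)=-1\}$ with the product $f\circ g=(Df)g$. It is the free (right-)Gelfand-Dorfman-Novikov algebra on $X$ (with $a\in X$ identified with $a[-1]$), where such algebras are defined by the identities $x\circ(y\circ z)-(x\circ y)\circ z=x\circ(z\circ y)-(x\circ z)\circ y$ and $x\circ(y\circ z)=y\circ(x\circ z)$. $Id(S)$ is the two-sided ideal of $(GDN(X),\circ)$ generated by $S$. $S$ is homogeneous if for every $f\in S$ all words occurring in $f$ with nonzero coefficient have the same length $|\cdot|$. For algorithmic purposes, arithmetic and equality testing in $k$ and comparison of elements of $X$ are regarded as effective primitive operations. *)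

(* Defs.v *)
From HB Require Import structures.
From mathcomp Require Import all_boot all_order all_algebra.
From mathcomp Require Import finmap.
From mathcomp Require Import monalg.

Set Implicit Arguments.
Unset Strict Implicit.
Unset Printing Implicit Defensive.

Import Order.TTheory GRing.Theory Num.Theory.

Local Open Scope fset_scope.
Local Open Scope ring_scope.

(** * The differential polynomial algebra k{X} and the Novikov product *)

(* The pair (a, j) stands for the letter a[j - 1], so that the indices
   i >= -1 are shifted to natural numbers. *)
Definition letter (X : choiceType) : choiceType := (X * nat)%type.

Notation word X := {cmonom (letter X)}.

Notation kalg k X := {malg k[word X]}.

(* The length |w| of a word is the library's [mdeg w]. *)
Definition wt (X : choiceType) (w : word X) : int :=
  \sum_(l <- finsupp w) (w l)%:Z * (l.2%:Z - 1).

Lemma Leibniz_lin (R : comNzRingType) (A : comAlgType R) (d : {linear A -> A})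
    (I J : Type) (r : seq I) (s : seq J) (a : I -> R) (b : J -> R)
    (F : I -> A) (G : J -> A) :
  (forall i j, d (F i * G j) = d (F i) * G j + F i * d (G j)) ->
  d ((\sum_(i <- r) a i *: F i) * (\sum_(j <- s) b j *: G j))
  = d (\sum_(i <- r) a i *: F i) * (\sum_(j <- s) b j *: G j)
    + (\sum_(i <- r) a i *: F i) * d (\sum_(j <- s) b j *: G j).
Proof.
move=> FG; elim: r => [|i r IHr].
  by rewrite big_nil linear0 !mul0r linear0 addr0.
rewrite big_cons mulrDl !linearD IHr /= !mulrDl [RHS]addrACA; congr (_ + _).
elim: s {IHr} => [|j s IHs].
  by rewrite big_nil linear0 !mulr0 linear0 addr0.
rewrite big_cons mulrDr !linearD IHs /= !mulrDr [RHS]addrACA; congr (_ + _).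
rewrite -scalerAl -scalerAr !linearZ /= FG -!scalerAl -!scalerAr.
by rewrite !scalerDr.
Qed.

Lemma rsym_der (A : comNzRingType) (d : A -> A) :
  (forall f g, d (f * g) = d f * g + f * d g) ->
  forall x y z, d x * (d y * z) - d (d x * y) * z
              = d x * (d z * y) - d (d x * z) * y.
Proof.
move=> dM x y z; rewrite !dM !mulrDl !opprD !mulrA.
by rewrite [- _ - _]addrC addrA subrr add0r [X in _ = _ + X]addrC addrA subrr
  add0r mulrAC.
Qed.

Section Differential.
Context (k : fieldType) (X : choiceType).

Definition letterU (l : letter X) : kalg k X := << ucm l >>.

(* The Leibniz rule on a word: each letter l, taken with its multiplicity in
   w, is replaced in turn by the next one. *)
Definition Dword (w : word X) : kalg k X :=
  \sum_(l <- finsupp w)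
    << (w l)%:R *g mmul (divcm w (ucm l)) (ucm (l.1, l.2.+1)) >>.

Definition D (f : kalg k X) : kalg k X :=
  \sum_(w <- msupp f) f@_w *: Dword w.

Definition circ (f g : kalg k X) : kalg k X := D f * g.

(* Words form a basis, so the span of the words of weight -1 consists of the
   elements all of whose words have weight -1. *)
Definition GDN : {pred kalg k X} :=
  fun f => all (fun w => wt w == -1) (msupp f).

Definition homogeneous (f : kalg k X) : Prop :=
  forall u v, u \in msupp f -> v \in msupp f -> mdeg u = mdeg v.

Definition is_ideal (I : kalg k X -> Prop) : Prop :=
  [/\ forall f, I f -> f \in GDN,
      I 0,
      forall (c : k) f g, I f -> I g -> I (c *: f + g),
      forall f g, I f -> g \in GDN -> I (circ f g)
    & forall f g, I f -> g \in GDN -> I (circ g f)].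

Definition Id (S : {fset kalg k X}) (f : kalg k X) : Prop :=
  forall I, is_ideal I -> (forall s, s \in S -> I s) -> I f.

(** Sanity checks: D is the derivation with D(a[i]) = a[i+1], circ satisfies
    the Gelfand-Dorfman-Novikov identities, and GDN is closed under circ. *)

Lemma D_linear (c : k) (f g : kalg k X) : D (c *: f + g) = c *: D f + D g.
Proof.
have DE h (E : {fset word X}) : msupp h `<=` E ->
    D h = \sum_(w <- E) h@_w *: Dword w.
  move=> hE; rewrite /D (big_fset_incl _ hE) // => w _ /mcoeff_outdom ->.
  by rewrite scale0r.
pose E := msupp f `|` msupp g.
have sE : msupp (c *: f + g) `<=` E.
  apply: fsubset_trans (msuppD_le _ _) _.
  by apply: fsetSU; apply: msuppZ_le.
rewrite (DE _ E) // (DE f E) ?fsubsetUl // (DE g E) ?fsubsetUr //.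
rewrite scaler_sumr -big_split /=; apply: eq_bigr => w _.
by rewrite mcoeffD mcoeffZ scalerDl scalerA.
Qed.

HB.instance Definition _ :=
  GRing.isLinear.Build k (kalg k X) (kalg k X) _ D D_linear.

Lemma D_word (w : word X) : D << w >> = Dword w.
Proof. by rewrite /D msuppU1 big_seq_fset1 mcoeffUU scale1r. Qed.

Lemma D_letter (a : X) (j : nat) : D (letterU (a, j)) = letterU (a, j.+1).
Proof.
rewrite /letterU D_word /Dword mdomU big_seq_fset1 cmUU.
have -> : divcm (ucm (a, j)) (ucm (a, j)) = mone :> word X.
  by apply/eqP/cmP => l; rewrite divcmE subnn cm1.
by rewrite mul1m.
Qed.

Lemma DwordE (w : word X) (E : {fset letter X}) : finsupp w `<=` E ->
  Dword w = \sum_(l <- E)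
    << (w l)%:R *g mmul (divcm w (ucm l)) (ucm (l.1, l.2.+1)) >>.
Proof.
move=> wE; rewrite /Dword (big_fset_incl _ wE) // => l _.
by rewrite -cmE_eq0 => /eqP ->; rewrite monalgU0.
Qed.

Lemma DwordM (u v : word X) :
  Dword (mmul u v) = Dword u * << v >> + << u >> * Dword v.
Proof.
have step (w v' : word X) (l : letter X) :
    << (w l)%:R *g mmul (divcm w (ucm l)) (ucm (l.1, l.2.+1)) >> * << v' >>
    = << (w l)%:R *g mmul (divcm (mmul w v') (ucm l)) (ucm (l.1, l.2.+1)) >>
    :> kalg k X.
  rewrite malgM_def fgmulUU mulr1.
  have [->|wl] := eqVneq (w l) 0%N; first by rewrite !monalgU0.
  rewrite -mulmA [mmul (ucm _) v']mulmC mulmA.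
  suff -> : mmul (divcm w (ucm l)) v' = divcm (mmul w v') (ucm l) by [].
  apply/eqP/cmP => i; rewrite cmM !divcmE cmM cmU.
  case: (eqVneq l i) => [<-|_] /=; last by rewrite !subn0.
  by rewrite addnBAC // lt0n.
have [E uE vE] : exists2 E : {fset letter X}, finsupp u `<=` E & finsupp v `<=` E.
  by exists (finsupp u `|` finsupp v); rewrite ?fsubsetUl ?fsubsetUr.
have uvE : finsupp (mmul u v) `<=` E by rewrite mdomD fsubUset uE.
rewrite (DwordE uE) (DwordE vE) (DwordE uvE).
have suml (F G H : letter X -> kalg k X) (g h : kalg k X) :
    (forall l, H l = F l * h + G l * g) ->
  \sum_(l <- E) H l = (\sum_(l <- E) F l) * h + g * (\sum_(l <- E) G l).
  move=> HE; rewrite mulr_suml [g * _]mulrC mulr_suml -big_split.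
  by apply: eq_bigr.
apply: suml => l; apply: etrans (esym (congr2 _ (step u v l) (step v u l))).
rewrite [mmul v u]mulmC.
rewrite -monalgUD.
by rewrite -natrD -cmM.
Qed.

Lemma D_Leibniz (f g : kalg k X) : D (f * g) = D f * g + f * D g.
Proof.
have UE c (w : word X) : << c *g w >> = c *: << w >> :> kalg k X.
  by apply/malgP => w'; rewrite [RHS]mcoeffZ [LHS]mcoeffU [in RHS]mcoeffU mulrnAr mulr1.
have UU (u v : word X) : << u >> * << v >> = << mmul u v >> :> kalg k X.
  by rewrite malgM_def fgmulUU mulr1.
have sumE (h : kalg k X) : h = \sum_(w <- msupp h) h@_w *: << w >>.
  by rewrite [LHS]monalgE; apply: eq_bigr => w _; exact: UE.
rewrite (sumE f) (sumE g); apply: Leibniz_lin => u v.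
have := DwordM u v; move: (D_word u) (D_word v) (D_word (mmul u v)).
by move=> <- <- <-; rewrite UU.
Qed.

Lemma circ_rsym (x y z : kalg k X) :
  circ x (circ y z) - circ (circ x y) z
  = circ x (circ z y) - circ (circ x z) y.
Proof.
exact: rsym_der D_Leibniz _ _ _.
Qed.

Lemma circ_lcom (x y z : kalg k X) :
  circ x (circ y z) = circ y (circ x z).
Proof. exact: mulrCA. Qed.

Lemma wtM (u v : word X) : wt (mmul u v) = wt u + wt v.
Proof.
have wtE (w : word X) (E : {fset letter X}) : finsupp w `<=` E ->
    wt w = \sum_(l <- E) (w l)%:Z * (l.2%:Z - 1).
  move=> wE; rewrite /wt (big_fset_incl _ wE) // => l _.
  by rewrite -cmE_eq0 => /eqP ->; rewrite mul0r.
pose E := finsupp u `|` finsupp v.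
rewrite (wtE _ E) ?mdomD ?fsubset_refl //.
rewrite (wtE u E) ?fsubsetUl // (wtE v E) ?fsubsetUr // -big_split /=.
by apply: eq_bigr => l _; rewrite cmM PoszD mulrDl.
Qed.

Lemma wtU (l : letter X) : wt (ucm l) = l.2%:Z - 1.
Proof. by rewrite /wt mdomU big_seq_fset1 cmUU mul1r. Qed.

Lemma GDNP (f : kalg k X) :
  reflect (forall w, w \in msupp f -> wt w = -1) (f \in GDN).
Proof.
rewrite unfold_in /GDN; apply: (iffP allP) => h w /h; first by move/eqP.
by move=> ->.
Qed.

Lemma GDN_circ (f g : kalg k X) :
  f \in GDN -> g \in GDN -> circ f g \in GDN.
Proof.
move=> /GDNP hf /GDNP hg; apply/GDNP => w /msuppM_le [u] [v] [hu hv ->].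
rewrite wtM (hg v hv); suff -> : wt u = 0 by rewrite add0r.
have Dsupp w' : w' \in msupp f -> u \in msupp (Dword w') -> wt u = 0.
  move=> /hf w1; rewrite /Dword => uD; apply/eqP; apply: contraLR uD => u0.
  rewrite -mcoeff_eq0 raddf_sum big_seq big1 //= => l lw.
  rewrite mcoeffU; case: eqP => // uE; case/eqP: u0; rewrite -uE wtM wtU /=.
  have wE : mmul (divcm w' (ucm l)) (ucm l) = w'.
    apply/eqP/cmP => i; rewrite cmM divcmE cmU.
    case: (eqVneq l i) => [<-|_] /=; last by rewrite subn0 addn0.
    by rewrite subnK // lt0n cmE_neq0.
  move: w1; rewrite -{1}wE wtM wtU => /eqP.
  rewrite addrA subr_eq addNr => /eqP e.
  by rewrite -addn1 PoszD addrK e.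
move: hu; rewrite -mcoeff_neq0 => /eqP uD; apply/eqP; apply/negPn/negP => u0.
apply: uD; rewrite /D raddf_sum big_seq big1 //= => w' hw'.
suff h : u \notin msupp (Dword w') by rewrite mcoeffZ (mcoeff_outdom h) mulr0.
by apply: contraNN u0 => h; apply/eqP; exact: Dsupp hw' h.
Qed.

End Differential.

Arguments GDN : clear implicits.

(** * Algorithms over a field k and an ordered set X

  A program is a finite piece of syntax built from data manipulation on
  booleans, natural numbers, pairs and lists, bounded recursion, unbounded
  loops, and the operations of k and X taken as primitives: field arithmetic
  and equality test in k, comparison in X. It may mention finitely many
  elements of k and X as constants. *)

Inductive ty : Type :=
| tBool | tNat | tScal | tGen
| tProd of ty & ty
| tList of ty.

Inductive prog (k X : Type) : ty -> ty -> Type :=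
| pId A : prog k X A A
| pComp A B C of prog k X B C & prog k X A B : prog k X A C
| pPair A B C of prog k X A B & prog k X A C : prog k X A (tProd B C)
| pFst A B : prog k X (tProd A B) A
| pSnd A B : prog k X (tProd A B) B
| pBool A of bool : prog k X A tBool
| pIf A B of prog k X A tBool & prog k X A B & prog k X A B : prog k X A B
| pZero A : prog k X A tNat
| pSucc : prog k X tNat tNat
| pRecN A B of prog k X A B & prog k X (tProd A (tProd tNat B)) B :
    prog k X (tProd A tNat) B
| pNil A B : prog k X A (tList B)
| pCons A : prog k X (tProd A (tList A)) (tList A)
| pRecL A E B
    of prog k X A B & prog k X (tProd A (tProd E (tProd (tList E) B))) B :
    prog k X (tProd A (tList E)) B
| pWhile A of prog k X A tBool & prog k X A A : prog k X A A
| pScal A of k : prog k X A tScal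
| pAdd : prog k X (tProd tScal tScal) tScal
| pOpp : prog k X tScal tScal
| pMul : prog k X (tProd tScal tScal) tScal
| pInv : prog k X tScal tScal
| pEqScal : prog k X (tProd tScal tScal) tBool
| pGen A of X : prog k X A tGen
| pLeGen : prog k X (tProd tGen tGen) tBool.

Inductive loops (T : Type) (test : T -> bool -> Prop) (step : T -> T -> Prop) :
  T -> T -> Prop :=
| loops_stop x of test x false : loops test step x x
| loops_step x y z of test x true & step x y & loops test step y z :
    loops test step x z.

Section Semantics.
Context (k : fieldType) (d : Order.disp_t) (X : orderType d).

Fixpoint den (A : ty) : Type :=
  match A with
  | tBool => bool
  | tNat => nat
  | tScal => k
  | tGen => X
  | tProd A B => (den A * den B)%type
  | tList A => seq (den A)
  end.

(* [run p x y]: the program p started on the input x halts with output y.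
   As usual in the library, the inverse of 0 is 0. *)
Fixpoint run (A B : ty) (p : prog k X A B) {struct p} :
    den A -> den B -> Prop :=
  match p in prog _ _ A B return den A -> den B -> Prop with
  | pId _ => fun x y => y = x
  | pComp _ _ _ q p => fun x z => exists y, run p x y /\ run q y z
  | pPair _ _ _ p q => fun x y => run p x y.1 /\ run q x y.2
  | pFst _ _ => fun x y => y = x.1
  | pSnd _ _ => fun x y => y = x.2
  | pBool _ b => fun _ y => y = b
  | pIf _ _ c p q => fun x y =>
      (run c x true /\ run p x y) \/ (run c x false /\ run q x y)
  | pZero _ => fun _ y => y = 0%N
  | pSucc => fun x y => y = x.+1
  | pRecN A B p q => fun x =>
      (fix rec (n : nat) : den B -> Prop :=
         match n with
         | 0%N => fun y => run p x.1 y
         | m.+1 => fun y => exists r, rec m r /\ run q (x.1, (m, r)) y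
         end) x.2
  | pNil _ _ => fun _ y => y = [::]
  | pCons _ => fun x y => y = x.1 :: x.2
  | pRecL A E B p q => fun x =>
      (fix rec (s : seq (den E)) : den B -> Prop :=
         match s with
         | [::] => fun y => run p x.1 y
         | e :: s' => fun y =>
             exists r, rec s' r /\ run q (x.1, (e, (s', r))) y
         end) x.2
  | pWhile _ c p => loops (run c) (run p)
  | pScal _ c => fun _ y => y = c
  | pAdd => fun x y => y = x.1 + x.2
  | pOpp => fun x y => y = - x
  | pMul => fun x y => y = x.1 * x.2
  | pInv => fun x y => y = x^-1
  | pEqScal => fun x y => y = (x.1 == x.2)
  | pGen _ a => fun _ y => y = a
  | pLeGen => fun x y => y = (x.1 <= x.2)%O
  end.

Lemma run_det (A B : ty) (p : prog k X A B) x y z :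
  run p x y -> run p x z -> y = z.
Proof.
elim: A B / p x y z => /= [A|A B C q hq p hp|A B C p hp q hq|A B|A B|A b
  |A B c hc p hp q hq|A||A B p hp q hq|A B|A|A E B p hp q hq|A c hc p hp
  |A c||||||A a|] x y z; try by move=> -> ->.
- by move=> [u [pu qu]] [v [pv]]; rewrite -(hp _ _ _ pu pv); apply: hq.
- case: y z => [y1 y2] [z1 z2] [/= p1 q1] [/= p2 q2].
  by rewrite (hp _ _ _ p1 p2) (hq _ _ _ q1 q2).
- move=> [] [c1 r1] [] [c2 r2]; have //= := hc _ _ _ c1 c2 => _.
    exact: hp r1 r2.
  exact: hq r1 r2.
- case: x => x n /=; elim: n y z => [|n IH] y z; first exact: hp.
  by move=> [r [hr yr]] [s [/(IH _ _ hr) <-]]; apply: hq yr.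
- case: x => x n /=; elim: n y z => [|e s IH] y z; first exact: hp.
  by move=> [r [hr yr]] [t [/(IH _ _ hr) <-]]; apply: hq yr.
- move=> h; elim: h z => {x y} [x cx|x y y' cx xy _ IH] z h.
    by case: h cx => // {}x x' z' ct _ _ cf; have := hc _ _ _ ct cf.
  case: h cx xy => [{}x cf ct|{}x x' z' _ xx' h _ xy].
    by have := hc _ _ _ ct cf.
  by apply: IH; rewrite (hp _ _ _ xy xx').
Qed.

(** * The word problem *)

Definition tWord : ty := tList (tProd tGen tNat).
Definition tElt : ty := tList (tProd tScal tWord).

(* An element of k{X} is given to an algorithm as any formal linear
   combination of words representing it, (a, j) standing for a[j - 1]. *)
Definition value (t : den tElt) : kalg k X :=
  \sum_(cw <- (t : seq (k * seq (X * nat))))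
    cw.1 *: \prod_(l <- cw.2) letterU k l.

Definition solvable_word_problem (S : {fset kalg k X}) : Prop :=
  exists p : prog k X tElt tBool,
    forall f : kalg k X, f \in GDN k X ->
    forall t : den tElt, value t = f ->
    exists b : bool, run p t b /\ (b <-> Id S f).

End Semantics.

(* Main.v *)
Require Import Defs.
From HB Require Import structures.
From mathcomp Require Import all_boot all_order all_algebra.
From mathcomp Require Import finmap.
From mathcomp Require Import monalg.
From mathcomp Require Import zify ring.

Set Implicit Arguments.
Unset Strict Implicit.
Unset Printing Implicit Defensive.

Import Order.TTheory GRing.Theory Num.Theory.

Local Open Scope fset_scope.
Local Open Scope ring_scope.

(** The ideal Id(S) is the weight -1 part of the differential ideal of k{X}
    generated by S, which is spanned by the products of a word with some
    D^t(s), s in S.  In a product of weight -1, a letter a[n] with n > 0 can be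
    grouped with n letters of index -1, and D^t(s) with t such letters; each
    group acts on Id(S) through the operations of GDN(X).

    All these products being homogeneous in weight, length and (up to the
    letters of S) content, the membership of f only involves those of length at
    most N and with letters a[i], i < N, a occurring in f or in S, where N
    bounds the length of the words of f.  These are finitely many, so that
    Gaussian elimination decides. *)

(** * Linear spans *)

Section LinearSpan.
Context (k : fieldType) (V : lmodType k).

(** Combinations are built one generator at a time, so that an induction treats a single generator
    at each step. *)
Inductive lspan (G : V -> Prop) : V -> Prop :=
| lspan0 : lspan G 0
| lspan_step c x y of G x & lspan G y : lspan G (c *: x + y).

Lemma lspan_lin (G : V -> Prop) c x y :
  lspan G x -> lspan G y -> lspan G (c *: x + y).
Proof.
move=> Gx Gy; elim: Gx => [|a u v Gu _ IH]; first by rewrite scaler0 add0r.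
by rewrite scalerDr scalerA -addrA; apply: lspan_step.
Qed.

Lemma lspan_gen (G : V -> Prop) x : G x -> lspan G x.
Proof.
by move=> Gx; rewrite -[x]addr0 -[x]scale1r; apply: lspan_step Gx (lspan0 G).
Qed.

Lemma lspan_sub (G : V -> Prop) (J : V -> Prop) :
  J 0 -> (forall c x y, J x -> J y -> J (c *: x + y)) ->
  (forall x, G x -> J x) -> forall x, lspan G x -> J x.
Proof. by move=> J0 JL GJ x; elim=> // c u v Gu _ Jv; apply: JL (GJ _ Gu) Jv. Qed.

End LinearSpan.

(** * Words presented by lists of letters *)

Section Words.
Context (k : fieldType) (X : choiceType).
Implicit Types (r : seq (letter X)) (w : word X) (f g : kalg k X).

(** Lists of letters are what the algorithm handles; two lists give the same word exactly when one
    is a permutation of the other. *)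
Definition wordof r : word X := \big[mmul/mone]_(l <- r) ucm l.

Definition mon r : kalg k X := \prod_(l <- r) letterU k l.

Lemma wordof_cons l r : wordof (l :: r) = mmul (ucm l) (wordof r).
Proof. exact: big_cons. Qed.

Lemma wordof_count r l : wordof r l = count_mem l r.
Proof.
elim: r => [|a r IH]; first by rewrite /wordof big_nil cm1.
by rewrite wordof_cons cmM cmU IH.
Qed.

Lemma mdeg_wordof r : mdeg (wordof r) = size r.
Proof.
elim: r => [|a r IH]; first by rewrite /wordof big_nil mdeg1.
by rewrite wordof_cons mdegM mdegU IH.
Qed.

Lemma mem_wordof r : finsupp (wordof r) =i r.
Proof.
by move=> l; rewrite -cmE_neq0 wordof_count -lt0n -has_count has_pred1.
Qed.

Lemma wt1 : wt (mone : word X) = 0.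
Proof. by rewrite /wt mdom1 big_seq_fset0. Qed.

Lemma wt_wordof r : wt (wordof r) = \sum_(l <- r) (l.2%:Z - 1).
Proof.
elim: r => [|a r IH]; first by rewrite /wordof !big_nil wt1.
by rewrite wordof_cons wtM wtU big_cons IH.
Qed.

(** Induction on the length, dividing out a letter of the support. *)
Lemma wordof_onto w : exists r, w = wordof r.
Proof.
have [n] := ubnP (mdeg w); elim: n w => // n IH w wn.
have [->|w0] := eqVneq w mone; first by exists [::]; rewrite /wordof big_nil.
have /fset0Pn [l lw] : finsupp w != fset0.
  apply: contraNneq w0 => w0; apply/eqP/mdeg_eq0I.
  by rewrite mdegE w0 big_seq_fset0.
have wE : w = mmul (ucm l) (divcm w (ucm l)).
  apply/eqP/cmP => i; rewrite cmM divcmE cmU.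
  case: (eqVneq l i) => [<-|_] /=; last by rewrite subn0.
  by rewrite subnKC // lt0n cmE_neq0.
have [|r rE] := IH (divcm w (ucm l)).
  by move: wn; rewrite {1}wE mdegM mdegU.
by exists (l :: r); rewrite wordof_cons -rE.
Qed.

Lemma malgUM (u v : word X) : << u >> * << v >> = << mmul u v >> :> kalg k X.
Proof. by rewrite malgM_def fgmulUU mulr1. Qed.

Lemma malgUZ c w : << c *g w >> = c *: << w >> :> kalg k X.
Proof.
by apply/malgP => v; rewrite [RHS]mcoeffZ [LHS]mcoeffU [in RHS]mcoeffU mulrnAr mulr1.
Qed.

Lemma monE r : mon r = << wordof r >>.
Proof.
elim: r => [|a r IH]; first by rewrite /mon /wordof !big_nil.
by rewrite /mon big_cons wordof_cons -malgUM -IH.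
Qed.

Lemma mon_cons l r : mon (l :: r) = letterU k l * mon r.
Proof. exact: big_cons. Qed.

Lemma mon_cat r r' : mon (r ++ r') = mon r * mon r'.
Proof. exact: big_cat. Qed.

Lemma mon_ind (J : kalg k X -> Prop) :
  J 0 -> (forall c f g, J f -> J g -> J (c *: f + g)) ->
  (forall r, J (mon r)) -> forall f, J f.
Proof.
move=> J0 JL Jm f; rewrite (monalgE f); elim/big_rec: _ => // w g _ Jg.
by rewrite malgUZ; apply: JL => //; have [r ->] := wordof_onto w; rewrite -monE.
Qed.

Lemma msuppUM (v w : word X) f :
  w \in msupp (<< v >> * f) -> exists2 u, u \in msupp f & w = mmul v u.
Proof.
move=> /msuppM_le [u] [u'] [].
rewrite msuppU1 => /fset1P -> uf ->; by exists u'.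
Qed.

End Words.

(* Stated over an abstract ring: [ring] does not terminate on [kalg k X]. *)
Section RingIdentities.
Context (A : comNzRingType).
Implicit Types a b c x y z : A.

Lemma prod_rule_mul y c a z b x :
  y * (c * a + z * b) * x = c * (y * (a * x)) + y * b * (z * x).
Proof. by ring. Qed.

Lemma prod_rule_sub a b c x z : b * (z * x) = - (a * c * z) + (b * x + a * c) * z.
Proof. by ring. Qed.

Lemma mul_exchange x y a b c : x * y * (a * b) * c = (x * a) * (y * b * c).
Proof. by ring. Qed.

End RingIdentities.

(** * The differential ideal generated by [S] *)

Section DifferentialIdeal.
Context (k : fieldType) (X : choiceType).
Implicit Types (r : seq (letter X)) (f g : kalg k X) (S : {fset kalg k X}).

Notation D := (@D k X).

Lemma D0 : D 0 = 0. Proof. exact: linear0. Qed.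

Lemma DZD c f g : D (c *: f + g) = c *: D f + D g.
Proof. exact: linearP. Qed.

Lemma D1 : D 1 = 0.
Proof.
by have /eqP := D_Leibniz (1 : kalg k X) 1; rewrite !mul1r mulr1 -subr_eq subrr => /eqP.
Qed.

(** These products are enough: their span is stable under multiplication by k{X} and, by the Leibniz
    rule, under [D]. *)
Definition dideal_gen S g : Prop :=
  exists r t s, s \in S /\ g = mon k r * iter t D s.

Definition dideal S : kalg k X -> Prop := lspan (dideal_gen S).

Lemma dideal_mul S f g : dideal S f -> dideal S (g * f).
Proof.
elim/mon_ind: g => [|c g h IHg IHh|r] Sf.
- by rewrite mul0r; apply: lspan0.
- by rewrite mulrDl -scalerAl; apply: lspan_lin; [exact: IHg|exact: IHh].
- elim: Sf => [|c x y [r' [t [s [sS ->]]]] _ IH].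
    by rewrite mulr0; apply: lspan0.
  rewrite mulrDr -scalerAr; apply: lspan_step IH.
  by exists (r ++ r'), t, s; rewrite mon_cat mulrA.
Qed.

Lemma dideal_D S f : dideal S f -> dideal S (D f).
Proof.
elim=> [|c x y [r [t [s [sS ->]]]] _ IH]; first by rewrite D0; apply: lspan0.
rewrite DZD; apply: lspan_lin IH; rewrite D_Leibniz -[X in X + _]scale1r.
apply: lspan_lin; last by apply: lspan_gen; exists r, t.+1, s.
apply: dideal_mul; apply: lspan_gen; exists [::], t, s.
by rewrite /mon big_nil mul1r.
Qed.

Lemma dideal_base S s : s \in S -> dideal S s.
Proof.
move=> sS; apply: lspan_gen; exists [::], 0, s.
by rewrite /mon big_nil mul1r.
Qed.

Lemma GDN_lin c f g : f \in GDN k X -> g \in GDN k X -> c *: f + g \in GDN k X.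
Proof.
move=> /GDNP hf /GDNP hg; apply/GDNP => w.
move/(fsubsetP (msuppD_le _ _)); rewrite in_fsetU => /orP [|]; last exact: hg.
move/(fsubsetP (msuppZ_le _ _)); exact: hf.
Qed.

(** The elements of the differential ideal that lie in GDN(X) form an ideal for [circ], since [circ]
    only derives and multiplies. *)
Lemma Id_dideal S f : (forall s, s \in S -> s \in GDN k X) -> Id S f -> dideal S f.
Proof.
move=> SG /(_ (fun g => g \in GDN k X /\ dideal S g)) [] //; last first.
  by move=> s sS; split; [exact: SG|exact: dideal_base].
split.
- by move=> g [].
- by split; [apply/GDNP => w; rewrite msupp0|exact: lspan0].
- by move=> c g h [Gg Sg] [Gh Sh]; split; [exact: GDN_lin|exact: lspan_lin].
- move=> g h [Gg Sg] Gh; split; first exact: GDN_circ.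
  by rewrite /circ mulrC; apply/dideal_mul/dideal_D.
- move=> g h [Gg Sg] Gh; split; first exact: GDN_circ.
  by apply: dideal_mul.
Qed.

(** * Absorption of the letters of index -1 *)

Notation low as_ := (mon k [seq (a, 0%N) | a <- as_]).

Lemma low_GDN a : letterU k (a, 0%N) \in GDN k X.
Proof.
by apply/GDNP => w; rewrite /letterU msuppU1 => /fset1P ->; rewrite wtU sub0r.
Qed.

Section LowClosed.
(** [N] is a subspace stable under left and right [circ]-products with the letters a[-1]. It will be
    either an ideal of GDN(X) or the set of multipliers of such an ideal. *)
Variable N : kalg k X -> Prop.
Hypothesis N0 : N 0.
Hypothesis NL : forall c f g, N f -> N g -> N (c *: f + g).
Hypothesis ND : forall a f, N f -> N (D (letterU k (a, 0%N)) * f).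
Hypothesis NR : forall a f, N f -> N (D f * letterU k (a, 0%N)).

(** By the Leibniz rule each term of [D (low u)] contains one a[0], absorbed by [ND], and leaves [n]
    letters of index -1 to go with [y]. The list [v] collects the letters already passed. *)
Let closed_Dlow y n :
  (forall u : seq X, size u = n -> N (y * low u)) ->
  forall u v : seq X, (size u + size v = n.+1)%N -> N (y * D (low u) * low v).
Proof.
move=> Ny; elim=> [|b u IH] v uv.
  by rewrite {1}/mon big_nil D1 mulr0 mul0r.
rewrite /= mon_cons D_Leibniz.
rewrite prod_rule_mul -[X in X + _]scale1r -mon_cat -map_cat -mon_cons.
apply: NL; first by apply: ND; apply: Ny; rewrite size_cat; move: uv => /= [].
by apply: (IH (b :: v)); rewrite /= addnS.
Qed.

(** Induction on [t] through D(h) z x = D(h x) z - h D(x) z, where h = D^t(f), z is the first letter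
    of [u] and x the product of the others: h x lies in [N] by induction, and [closed_Dlow] handles
    h D(x) z. *)
Lemma iterD_low t f (u : seq X) : N f -> size u = t -> N (iter t D f * low u).
Proof.
move=> Nf; elim: t u => [|t IH] u ut.
  by rewrite (size0nil ut) /mon big_nil mulr1.
case: u ut => // a u [ut]; rewrite /= mon_cons.
have z1 : letterU k (a, 0%N) = low [:: a] by rewrite mon_cons [mon k _]big_nil mulr1.
rewrite (prod_rule_sub (iter t D f) (D (iter t D f)) (D (low u)) (low u)
  (letterU k (a, 0%N))).
rewrite -[X in X + _]scaleN1r -(D_Leibniz (iter t D f) (low u)) {1}z1.
apply: NL; last by apply: NR; apply: IH.
by apply: closed_Dlow IH _ _ _; rewrite /= ut addn1.
Qed.

End LowClosed.

(** A pair (a, n) of [o] records a letter a[n] with n >= 0, stored in [r] as (a, n.+1). The weight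
    is then the sum of these n minus the number of letters of index -1. *)
Lemma word_split r : exists (o : seq (letter X)) (u : seq X),
  mon k r = mon k [seq (l.1, l.2.+1) | l <- o] * low u
  /\ \sum_(l <- r) (l.2%:Z - 1) = (\sum_(l <- o) l.2)%N%:Z - (size u)%:Z.
Proof.
elim: r => [|[a [|n]] r [o [u [IHm IHw]]]].
- by exists [::], [::]; rewrite /mon !big_nil mulr1.
- exists o, (a :: u); rewrite big_cons IHw; split; last by clear; rewrite /=; lia.
  rewrite (mon_cons k (a, 0%N) r) IHm [map _ (a :: u)]/=
    (mon_cons k (a, 0%N) [seq (b, 0%N) | b <- u]).
  exact: (mulrCA (letterU k (a, 0%N)) (mon k _) (low u)).
- exists ((a, n) :: o), u; rewrite !big_cons IHw; split.
    rewrite (mon_cons k (a, n.+1) r) IHm [map _ (_ :: o)]/=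
      (mon_cons k (a, n.+1) [seq (l.1, l.2.+1) | l <- o]).
    exact: (mulrA (letterU k (a, n.+1)) (mon k _) (low u)).
  by clear; rewrite /=; lia.
Qed.

(** The weight condition says that the letters of index -1 are exactly as many as needed: n for each
    a[n] with n >= 0, and [t] for D^t(f). *)
Lemma ideal_mon (I : kalg k X -> Prop) r t f :
  is_ideal I -> I f -> \sum_(l <- r) (l.2%:Z - 1) = - t%:Z ->
  I (mon k r * iter t D f).
Proof.
move=> [IG I0 IL Ir Il] If; have [o [u [-> ->]]] := word_split r => wr.
have {wr} : size u = ((\sum_(l <- o) l.2) + t)%N by lia.
(* The multipliers of [I] satisfy the hypotheses of [iterD_low], so a letter can be grouped with its
   share of [u] before it meets an element of [I]. *)
pose N p := forall g, I g -> I (p * g).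
have NI n p (v : seq X) : N p -> size v = n -> N (iter n D p * low v).
  apply: iterD_low => {p v n}.
  - by move=> g _; rewrite mul0r.
  - move=> c p q Np Nq g Ig; rewrite mulrDl -scalerAl.
    by apply: IL; [exact: Np|exact: Nq].
  - move=> a p Np g Ig; rewrite -mulrA.
    by apply: Il _ (low_GDN a); exact: Np.
  - move=> a p Np g Ig.
    (* (Dp) z g = D(p g) z - p (Dg) z, where D(p g) z is [circ (p * g) z], and (Dg) z is [circ g z],
       which [p] then multiplies. *)
    set z := letterU k (a, 0%N); rewrite -(mulrA (D p) z g).
    rewrite (prod_rule_sub p (D p) (D g) g z) -[X in X + _]scaleN1r.
    rewrite -[X in _ + X * z](D_Leibniz p g) -[X in _ *: X](mulrA p (D g) z).
    apply: IL; first by apply: Np; apply: Ir (low_GDN a).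
    by apply: Ir (low_GDN a); exact: Np.
elim: o u => [|[a n] o IH] u.
  (* Only the [t] letters meant for D^t(f) remain; they are absorbed inside [I] itself. *)
  rewrite big_nil add0n [mon k (map _ [::])]/mon big_nil mul1r mulrC => ut.
  apply: iterD_low If ut => //.
  - by move=> a g Ig; apply: Il _ (low_GDN a).
  - by move=> a g Ig; apply: Ir _ (low_GDN a).
rewrite big_cons /= => un; rewrite mon_cons -[u](cat_take_drop n) map_cat mon_cat.
(* a[n] is D^n(a[0]), and a[0] is a multiplier because multiplying by it is the left product with
   a[-1]. It takes the first [n] letters of [u]. *)
have -> : letterU k (a, n.+1) = iter n D (D (letterU k (a, 0%N))).
  by rewrite D_letter; elim: n {un} => //= n <-; rewrite D_letter.
set x := iter n D _; set y := mon k (map _ o).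
rewrite (mul_exchange x y (low (take n u)) (low (drop n u)) (iter t D f)).
apply: NI.
- by move=> g Ig; apply: Il (low_GDN a).
- by rewrite size_takel // un -addnA leq_addr.
- by apply: IH; rewrite size_drop un -addnA addKn.
Qed.

End DifferentialIdeal.

(** * Homogeneous parts of the differential ideal *)

Section Homogeneity.
Context (k : fieldType) (X : choiceType).
Implicit Types (r : seq (letter X)) (f g : kalg k X) (S : {fset kalg k X}).
Implicit Types (w : word X) (Y : seq X).

Lemma msupp_lin (P : word X -> Prop) c f g :
  (forall w, w \in msupp f -> P w) -> (forall w, w \in msupp g -> P w) ->
  forall w, w \in msupp (c *: f + g) -> P w.
Proof.
move=> hf hg w /(fsubsetP (msuppD_le _ _)); rewrite in_fsetU => /orP [|/hg //].
by move/(fsubsetP (msuppZ_le _ _)) => /hf.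
Qed.

Lemma mcoeff_lin w c f g : (c *: f + g)@_w = c * f@_w + g@_w.
Proof. by rewrite [LHS]mcoeffD [X in X + _]mcoeffZ. Qed.

Definition hom (a : int) (m : nat) Y f : Prop := forall w, w \in msupp f ->
  [/\ wt w = a, mdeg w = m & forall l, l \in finsupp w -> l.1 \in Y].

(** Each term of [Dword w] raises the index of one letter of [w] by one. *)
Lemma hom_D a m Y f : hom a m Y f -> hom (a + 1) m Y (D f).
Proof.
move=> hf; rewrite /D big_seq.
elim/big_rec: _ => [w|w g wf hg]; first by rewrite msupp0.
apply: msupp_lin hg; rewrite /Dword big_seq.
elim/big_rec: _ => [v|l h lw hh]; first by rewrite msupp0.
rewrite malgUZ; apply: msupp_lin hh => w'.
rewrite msuppU1 => /fset1P ->; have [<- <- Yw] := hf w wf.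
have wE : mmul (divcm w (ucm l)) (ucm l) = w.
  apply/eqP/cmP => i; rewrite cmM divcmE cmU.
  case: (eqVneq l i) => [<-|_] /=; last by rewrite subn0 addn0.
  by rewrite subnK // lt0n cmE_neq0.
split.
- rewrite -{2}wE !wtM !wtU -addrA; congr (_ + _).
  by rewrite subrK -addn1 PoszD addrK.
- by rewrite -{2}wE !mdegM !mdegU.
- move=> l'; rewrite mdomD in_fsetU => /orP [l'w|].
    by apply: Yw; rewrite -wE mdomD in_fsetU l'w.
  by rewrite mdomU => /fset1P -> /=; apply: Yw.
Qed.

Lemma hom_iterD a m Y f t : hom a m Y f -> hom (a + t%:Z) m Y (iter t (@D k X) f).
Proof.
move=> hf; elim: t => [|t IH]; first by rewrite addr0.
by rewrite -addn1 PoszD addrA addn1; apply: hom_D.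
Qed.

(** [Q] is constant on the support of each generator, so the projection onto the words satisfying
    [Q] sends a generator to itself or to 0. It maps the differential ideal into [J], and it fixes
    [f]. *)
Lemma dideal_proj S (Q : pred (word X)) (J : kalg k X -> Prop) f :
  J 0 -> (forall c f g, J f -> J g -> J (c *: f + g)) ->
  (forall r t s, s \in S -> exists2 b : bool,
     b -> J (mon k r * iter t (@D k X) s) &
     forall w, w \in msupp (mon k r * iter t (@D k X) s) -> Q w = b) ->
  dideal S f -> (forall w, w \in msupp f -> Q w) -> J f.
Proof.
move=> J0 JL Jgen Sf Qf.
have [g Jg gE] : exists2 g, J g & forall w, g@_w = if Q w then f@_w else 0.
  elim: Sf {Qf} => [|c x y [r [t [s [sS ->]]]] _ [g Jg gE]].
    by exists 0 => // w; rewrite mcoeff0 if_same.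
  have [b Jb Qb] := Jgen r t s sS; set h := mon k r * _ in Jb Qb *.
  (* The projection of a combination drops the generators whose words fail [Q]. *)
  exists ((if b then c else 0) *: h + g).
    case: b Jb {Qb} => Jb; first by apply: JL => //; apply: Jb.
    by rewrite scale0r add0r.
  move=> w; rewrite (mcoeff_lin w _ h g) (mcoeff_lin w c h y) gE.
  have [wh|wh] := boolP (w \in msupp h); last first.
    by rewrite (mcoeff_outdom wh) !mulr0 !add0r.
  by rewrite (Qb _ wh); case: (b); rewrite ?mul0r ?add0r.
suff -> : f = g by [].
apply/malgP => w; rewrite gE; case: ifPn => // Qw.
by apply: mcoeff_outdom; apply: contraNN Qw => /Qf.
Qed.

(** A word of the support is the word of [r] times a word of D^t(f), and everything is read off from
    the two factors. *)
Lemma msupp_mon_iterD a m Y r t f w : hom a m Y f ->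
  w \in msupp (mon k r * iter t (@D k X) f) ->
  [/\ wt w = \sum_(l <- r) (l.2%:Z - 1) + (a + t%:Z), mdeg w = (size r + m)%N
    & forall l, l \in finsupp w -> l \notin r -> l.1 \in Y]
  /\ {subset r <= finsupp w}.
Proof.
move=> hf; rewrite monE => /msuppUM [u uf ->].
have [<- <- Yu] := hom_iterD hf uf; rewrite wtM mdegM wt_wordof mdeg_wordof.
split; [split=> // l|move=> l]; rewrite mdomD in_fsetU mem_wordof.
  by case/orP => [->//|/Yu].
by move=> ->.
Qed.

Definition gens f : seq X := flatten [seq [seq l.1 | l <- finsupp w] | w <- msupp f].

Lemma hom_gens f Y :
  f \in GDN k X -> homogeneous f -> {subset gens f <= Y} ->
  exists m, hom (-1) m Y f.
Proof.
move=> /GDNP Gf Hf sY.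
have Yf w l : w \in msupp f -> l \in finsupp w -> l.1 \in Y.
  move=> wf lw; apply: sY; apply/flatten_mapP; exists w => //.
  exact: map_f.
have [f0|/fset0Pn [v vf]] := eqVneq (msupp f) fset0.
  (* For f = 0 any length will do. *)
  by exists 0 => w; rewrite f0.
exists (mdeg v) => w wf; split; [exact: Gf|exact: Hf|].
by move=> l; apply: Yf.
Qed.

(** For the converse, project onto weight -1: the product of [r] and D^t(s) has the single weight
    wt(r) + t - 1, and when this is -1, [ideal_mon] puts the product in every ideal containing
    [S]. *)
Lemma Id_iff_dideal S f :
  (forall s, s \in S -> s \in GDN k X) -> (forall s, s \in S -> homogeneous s) ->
  f \in GDN k X -> Id S f <-> dideal S f.
Proof.
move=> SG SH Gf; split; first exact: Id_dideal.
move=> Sf I idI SI; have [IG I0 IL _ _] := idI.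
apply: (@dideal_proj S (fun w => wt w == -1)) Sf _ => //; last first.
  by move=> w /(GDNP _ Gf) ->.
move=> r t s sS; have [m hs] := hom_gens (SG _ sS) (SH _ sS) (fun x => id).
exists (\sum_(l <- r) (l.2%:Z - 1) == - t%:Z).
  by move/eqP; apply: ideal_mon => //; apply: SI.
move=> w /(msupp_mon_iterD hs) [[-> _ _] _].
by rewrite addrCA -[X in _ == X]addr0 (inj_eq (addrI _)) addr_eq0.
Qed.

End Homogeneity.

(** * Computable functions *)

Section Computability.
Context (k : fieldType) (d : Order.disp_t) (X : orderType d).

Notation den := (den k X).

(** The program halts on every input, so an algorithm can be written as an ordinary total function
    and compiled piece by piece. *)
Definition cpt (A B : ty) (f : den A -> den B) : Prop :=
  exists p : prog k X A B, forall x, run p x (f x).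

Lemma cpt_ext A B (f g : den A -> den B) : f =1 g -> cpt f -> cpt g.
Proof. by move=> fg [p pf]; exists p => x; rewrite -fg. Qed.

Lemma cpt_id A : cpt (fun x : den A => x).
Proof. by exists (pId k X A). Qed.

Lemma cpt_comp A B C (g : den B -> den C) (f : den A -> den B) :
  cpt g -> cpt f -> cpt (fun x => g (f x)).
Proof. by move=> [q qg] [p pf]; exists (pComp q p) => x; exists (f x). Qed.

Lemma cpt_pair A B C (f : den A -> den B) (g : den A -> den C) :
  cpt f -> cpt g -> cpt (B := tProd B C) (fun x => (f x, g x)).
Proof. by move=> [p pf] [q qg]; exists (pPair p q) => x; split. Qed.

Lemma cpt_fst A B C (f : den A -> den (tProd B C)) :
  cpt f -> cpt (B := B) (fun x => (f x).1).
Proof. by apply: cpt_comp; exists (pFst k X B C). Qed.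

Lemma cpt_snd A B C (f : den A -> den (tProd B C)) :
  cpt f -> cpt (B := C) (fun x => (f x).2).
Proof. by apply: cpt_comp; exists (pSnd k X B C). Qed.

Lemma cpt_if A B (c : den A -> den tBool) (f g : den A -> den B) :
  cpt c -> cpt f -> cpt g -> cpt (fun x => if c x then f x else g x).
Proof.
move=> [r rc] [p pf] [q qg]; exists (pIf r p q) => x /=.
by have := rc x; case: (c x) => cx; [left|right].
Qed.

Lemma cpt_succ A (f : den A -> den tNat) :
  cpt f -> cpt (B := tNat) (fun x => (f x).+1).
Proof. by apply: cpt_comp; exists (pSucc k X). Qed.

Lemma cpt_cons A E (e : den A -> den E) (s : den A -> den (tList E)) :
  cpt e -> cpt s -> cpt (B := tList E) (fun x => e x :: s x).
Proof.
move=> ce cs; apply: (cpt_comp (A := A) (B := tProd E (tList E)) (C := tList E)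
  (g := fun p => p.1 :: p.2) (f := fun x => (e x, s x))); last exact: cpt_pair.
by exists (pCons k X E).
Qed.

(** A datum involves finitely many elements of [k] and [X], so it can be written into a program.
    This is how [S] becomes part of the decision program. *)
Lemma cpt_const A B (c : den B) : cpt (fun _ : den A => c).
Proof.
elim: B c => [b|n|a|a|B IHB C IHC [b c]|B IHB s].
- by exists (pBool k X A b).
- elim: n => [|n IH]; first by exists (pZero k X A).
  exact: cpt_succ IH.
- by exists (pScal X A a).
- by exists (pGen k A a).
- by apply: cpt_pair; [exact: IHB|exact: IHC].
- elim: s => [|b s IH]; first by exists (pNil k X A B).
  exact: cpt_cons.
Qed.

Lemma cpt_nrec A B (h : den A -> den tNat) (z : den A -> den B)
    (g : den A -> nat -> den B -> den B) :
  cpt h -> cpt z ->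
  cpt (A := tProd A (tProd tNat B)) (fun p => g p.1 p.2.1 p.2.2) ->
  cpt (fun x => nat_rect (fun _ => den B) (z x) (g x) (h x)).
Proof.
move=> ch [p pz] [q qg].
apply: (cpt_comp (B := tProd A tNat)
  (g := fun y => nat_rect (fun _ => den B) (z y.1) (g y.1) y.2)
  (f := fun x => (x, h x))); last by apply: cpt_pair ch; exact: cpt_id.
exists (pRecN p q) => -[x n] /=; elim: n => [|n IH] /=; first exact: pz.
by eexists; split; [exact: IH|exact: (qg (x, (n, _)))].
Qed.

Lemma cpt_iter A B (h : den A -> den tNat) (z : den A -> den B)
    (g : den A -> den B -> den B) :
  cpt h -> cpt z -> cpt (A := tProd A B) (fun p => g p.1 p.2) ->
  cpt (fun x => iter (h x) (g x) (z x)).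
Proof.
move=> ch cz cg.
apply: (@cpt_ext _ _ (fun x => nat_rect (fun _ => den B) (z x) (fun _ => g x) (h x))).
  by move=> x; elim: (h x) => //= n ->.
apply: cpt_nrec => //.
refine (cpt_comp (A := tProd A (tProd tNat B)) (B := tProd A B)
  (f := fun p => (p.1, p.2.2)) cg _).
apply: cpt_pair; first exact: cpt_fst (cpt_id _).
exact: cpt_snd (cpt_snd (cpt_id _)).
Qed.

(** [pRecL] also hands the tail of the list to its step; the program for [g] is composed with a
    projection that forgets it. *)
Lemma cpt_foldr A E B (h : den A -> den (tList E)) (z : den A -> den B)
    (g : den A -> den E -> den B -> den B) :
  cpt h -> cpt z ->
  cpt (A := tProd A (tProd E B)) (fun p => g p.1 p.2.1 p.2.2) ->
  cpt (fun x => foldr (g x) (z x) (h x)).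
Proof.
move=> ch [p pz] cg.
have {cg} [q qg] : cpt (A := tProd A (tProd E (tProd (tList E) B)))
    (fun p => g p.1 p.2.1 p.2.2.2).
  refine (cpt_comp (A := tProd A (tProd E (tProd (tList E) B)))
    (B := tProd A (tProd E B)) (f := fun p => (p.1, (p.2.1, p.2.2.2))) cg _).
  have c2 := cpt_snd (cpt_id (tProd A (tProd E (tProd (tList E) B)))).
  apply: cpt_pair; first exact: cpt_fst (cpt_id _).
  by apply: cpt_pair; [exact: cpt_fst c2|exact: cpt_snd (cpt_snd c2)].
apply: (cpt_comp (B := tProd A (tList E))
  (g := fun y => foldr (g y.1) (z y.1) y.2)
  (f := fun x => (x, h x))); last by apply: cpt_pair ch; exact: cpt_id.
exists (pRecL p q) => -[x s] /=; elim: s => [|e s IH] /=; first exact: pz.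
by eexists; split; [exact: IH|exact: (qg (x, (e, (s, _))))].
Qed.

End Computability.

Arguments cpt_id {k d X} A.
Arguments cpt_const {k d X} A {B} c.

Ltac ty_of A f :=
  lazymatch f with
  | (fun p => p) => constr:(A)
  | (fun p => fst (@?g p)) => let T := ty_of A g in
      lazymatch eval hnf in T with tProd ?U _ => constr:(U) end
  | (fun p => snd (@?g p)) => let T := ty_of A g in
      lazymatch eval hnf in T with tProd _ ?U => constr:(U) end
  end.

(* The argument types of a projection cannot be inferred from its denotation,
   as [den] is not injective for unification. *)
Ltac cpt_var :=
  lazymatch goal with
  | |- cpt (A := ?A) (fun p => p) => exact: cpt_id
  | |- @cpt ?k ?d ?X ?A _ (@fst _ _) =>
      lazymatch eval hnf in A with
      | tProd ?U ?V => exact (@cpt_fst k d X A U V (fun x => x) (@cpt_id k d X A)) end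
  | |- @cpt ?k ?d ?X ?A _ (@snd _ _) =>
      lazymatch eval hnf in A with
      | tProd ?U ?V => exact (@cpt_snd k d X A U V (fun x => x) (@cpt_id k d X A)) end
  | |- @cpt ?k ?d ?X ?A _ (fun p => fst (@?f p)) => let T := ty_of A f in
      lazymatch eval hnf in T with
      | tProd ?U ?V => refine (@cpt_fst k d X A U V f _); cpt_var end
  | |- @cpt ?k ?d ?X ?A _ (fun p => snd (@?f p)) => let T := ty_of A f in
      lazymatch eval hnf in T with
      | tProd ?U ?V => refine (@cpt_snd k d X A U V f _); cpt_var end
  | |- _ => exact: cpt_const
  end.

(** * Computable operations on lists, numbers, words and scalars *)

Section ComputableOperations.
Context (k : fieldType) (d : Order.disp_t) (X : orderType d).

Notation den := (den k X).
Notation tLet := (tProd tGen tNat).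

Lemma cpt_cat A E (s t : den A -> den (tList E)) :
  cpt s -> cpt t -> cpt (B := tList E) (fun x => s x ++ t x).
Proof.
move=> cs ct; apply: (@cpt_ext _ _ _ A (tList E) (fun x => foldr cons (t x) (s x))).
  by move=> x; elim: (s x) => //= e u ->.
refine (cpt_foldr (E := E) (B := tList E) (g := fun _ => cons) cs ct _).
by apply: cpt_cons; cpt_var.
Qed.

Lemma cpt_map A E F (g : den A -> den E -> den F) (s : den A -> den (tList E)) :
  cpt s -> cpt (A := tProd A E) (fun p => g p.1 p.2) ->
  cpt (B := tList F) (fun x => [seq g x e | e <- s x]).
Proof.
move=> cs cg; refine (cpt_foldr (E := E) (B := tList F)
  (g := fun x e r => g x e :: r) cs (cpt_const A _) _).
apply: cpt_cons; last by cpt_var.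
refine (cpt_comp (A := tProd A (tProd E (tList F))) (B := tProd A E)
  (f := fun p => (p.1, p.2.1)) cg _).
by apply: cpt_pair; cpt_var.
Qed.

Lemma cpt_flatmap A E F (g : den A -> den E -> den (tList F))
    (s : den A -> den (tList E)) :
  cpt s -> cpt (A := tProd A E) (fun p => g p.1 p.2) ->
  cpt (B := tList F) (fun x => flatten [seq g x e | e <- s x]).
Proof.
move=> cs cg.
apply: (@cpt_ext _ _ _ A (tList F) (fun x => foldr (fun e r => g x e ++ r) [::] (s x))).
  by move=> x; elim: (s x) => //= e u ->.
refine (cpt_foldr (E := E) (B := tList F)
  (g := fun x e r => g x e ++ r) cs (cpt_const A _) _).
apply: cpt_cat; last by cpt_var.
refine (cpt_comp (A := tProd A (tProd E (tList F))) (B := tProd A E)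
  (f := fun p => (p.1, p.2.1)) cg _).
by apply: cpt_pair; cpt_var.
Qed.

Lemma cpt_andb A (b c : den A -> den tBool) :
  cpt b -> cpt c -> cpt (B := tBool) (fun x => b x && c x).
Proof.
by move=> cb cc; apply: (cpt_if cb cc); apply: cpt_const.
Qed.

Lemma cpt_all A E (g : den A -> den E -> bool) (s : den A -> den (tList E)) :
  cpt s -> cpt (A := tProd A E) (B := tBool) (fun p => g p.1 p.2) ->
  cpt (B := tBool) (fun x => all (g x) (s x)).
Proof.
move=> cs cg.
refine (cpt_foldr (E := E) (B := tBool)
  (g := fun x e r => g x e && r) cs (cpt_const A _) _).
apply: cpt_andb; last by cpt_var.
refine (cpt_comp (A := tProd A (tProd E tBool)) (B := tProd A E)
  (f := fun p => (p.1, p.2.1)) cg _).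
by apply: cpt_pair; cpt_var.
Qed.

Lemma cpt_addn A (m n : den A -> den tNat) :
  cpt m -> cpt n -> cpt (B := tNat) (fun x => m x + n x)%N.
Proof.
move=> cm cn; apply: (@cpt_ext _ _ _ A tNat (fun x => iter (m x) S (n x))).
  by move=> x; rewrite iter_succn addnC.
refine (cpt_iter (B := tNat) (g := fun _ => S) cm cn _).
by apply: cpt_succ; cpt_var.
Qed.

(** Recursion gives the predecessor, its iteration truncated subtraction and hence the order;
    equality follows by antisymmetry. *)
Lemma cpt_eqn A (m n : den A -> den tNat) :
  cpt m -> cpt n -> cpt (B := tBool) (fun x => m x == n x :> nat).
Proof.
have cpred : cpt (k := k) (X := X) (A := tNat) (B := tNat) predn.
  refine (@cpt_ext k d X tNat tNat
    (fun n : nat => nat_rect (fun _ => nat) 0%N (fun m _ => m) n) predn _ _).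
    by case.
  refine (cpt_nrec (A := tNat) (B := tNat) (g := fun _ m _ => m) (cpt_id _) (cpt_const _ _) _).
  by cpt_var.
have csub (u v : den A -> den tNat) : cpt u -> cpt v ->
    cpt (B := tBool) (fun x => u x <= v x)%N.
  move=> cu cv.
  apply: (@cpt_ext _ _ _ _ tBool (fun x =>
    nat_rect (fun _ => bool) true (fun _ _ => false) (iter (v x) predn (u x)))).
    by move=> x; rewrite iter_predn /leq; case: (_ - _)%N.
  refine (cpt_nrec (B := tBool) (g := fun _ _ _ => false) _ (cpt_const _ _) (cpt_const _ _)).
  refine (cpt_iter (B := tNat) (g := fun _ => predn) cv cu _).
  by refine (cpt_comp (A := tProd A tNat) (B := tNat) cpred _); cpt_var.
move=> cm cn; apply: (@cpt_ext _ _ _ _ tBool (fun x => (m x <= n x) && (n x <= m x))%N).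
  by move=> x; rewrite -eqn_leq.
by apply: cpt_andb; apply: csub.
Qed.

(** Generators are compared by [pLeGen], so their equality is tested as the order in both
    directions. *)
Lemma cpt_eqlet A (l m : den A -> den tLet) :
  cpt l -> cpt m -> cpt (B := tBool) (fun x => l x == m x :> X * nat).
Proof.
move=> cl cm.
have cle (u v : den A -> den tGen) : cpt u -> cpt v ->
    cpt (B := tBool) (fun x => u x <= v x)%O.
  move=> cu cv; apply: (cpt_comp (B := tProd tGen tGen) (C := tBool) (g := fun p => (p.1 <= p.2)%O)
    (f := fun x => (u x, v x))); last exact: cpt_pair.
  by exists (pLeGen k X).
apply: (@cpt_ext _ _ _ _ tBool (fun x => [&& ((l x).1 <= (m x).1)%O,
  ((m x).1 <= (l x).1)%O & (l x).2 == (m x).2 :> nat])).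
  by move=> x; rewrite andbA -eq_le; case: (l x) (m x) => [a i] [b j].
have [l1 m1] := (cpt_fst cl, cpt_fst cm); have [l2 m2] := (cpt_snd cl, cpt_snd cm).
do ![apply: cpt_andb]; try exact: cle.
exact: cpt_eqn.
Qed.

Lemma cpt_perm A (u v : den A -> den tWord) :
  cpt u -> cpt v -> cpt (B := tBool) (fun x => perm_eq (u x : seq (X * nat)) (v x)).
Proof.
(* [perm_eq] unfolds to a comparison of multiplicities over all letters of the two lists. *)
move=> cu cv; apply: (cpt_all (E := tLet)); first exact: cpt_cat.
have ccount (w : den A -> den tWord) : cpt w ->
    cpt (A := tProd A tLet) (B := tNat) (fun p => count_mem p.2 (w p.1 : seq (X * nat))).
  move=> cw; apply: (@cpt_ext _ _ _ (tProd A tLet) tNat (fun p =>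
    foldr (fun l n => if l == p.2 :> X * nat then n.+1 else n) 0%N (w p.1))).
    by move=> p; elim: (w _) => //= l s ->; case: eqP.
  apply: (cpt_foldr (A := tProd A tLet) (E := tLet) (B := tNat)
    (g := fun p l n => if l == p.2 :> X * nat then n.+1 else n)).
  - by apply: cpt_comp cw _; cpt_var.
  - exact: cpt_const.
  - apply: cpt_if; last by cpt_var.
      by apply: cpt_eqlet; cpt_var.
    by apply: cpt_succ; cpt_var.
by apply: cpt_eqn; apply: ccount.
Qed.

Lemma cpt_add A (a b : den A -> den tScal) :
  cpt a -> cpt b -> cpt (B := tScal) (fun x => (a x : k) + b x).
Proof.
move=> ca cb; apply: (cpt_comp (B := tProd tScal tScal) (C := tScal) (g := fun p => (p.1 : k) + p.2)
    (f := fun x => (a x, b x))); last exact: cpt_pair.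
by exists (pAdd k X).
Qed.

Lemma cpt_mul A (a b : den A -> den tScal) :
  cpt a -> cpt b -> cpt (B := tScal) (fun x => (a x : k) * b x).
Proof.
move=> ca cb; apply: (cpt_comp (B := tProd tScal tScal) (C := tScal) (g := fun p => (p.1 : k) * p.2)
    (f := fun x => (a x, b x))); last exact: cpt_pair.
by exists (pMul k X).
Qed.

Lemma cpt_opp A (a : den A -> den tScal) :
  cpt a -> cpt (B := tScal) (fun x => - (a x : k)).
Proof. by apply: cpt_comp; exists (pOpp k X). Qed.

Lemma cpt_inv A (a : den A -> den tScal) :
  cpt a -> cpt (B := tScal) (fun x => (a x : k)^-1).
Proof. by apply: cpt_comp; exists (pInv k X). Qed.

Lemma cpt_eqs A (a b : den A -> den tScal) :
  cpt a -> cpt b -> cpt (B := tBool) (fun x => a x == b x :> k).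
Proof.
move=> ca cb; apply: (cpt_comp (B := tProd tScal tScal) (C := tBool) (g := fun p => p.1 == p.2 :> k)
    (f := fun x => (a x, b x))); last exact: cpt_pair.
by exists (pEqScal k X).
Qed.

End ComputableOperations.

(* Stated over an abstract module, since rewriting with ring laws in [kalg k X]
   does not terminate. *)
Lemma elimination_lin (k : fieldType) (V : lmodType k) (c p q r : k) (x y z : V) :
  c *: x + y + - ((c * p + q) / r) *: z
  = c *: (x + - (p / r) *: z) + (y + - (q / r) *: z).
Proof.
rewrite mulrDl opprD scalerDl scalerDr !scalerA addrACA.
by rewrite mulrN -mulrA.
Qed.

(** * Gaussian elimination on formal combinations *)

Section Algorithm.
Context (k : fieldType) (d : Order.disp_t) (X : orderType d).

Notation den := (den k X).
Notation wseq := (seq (X * nat)).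
Notation elt := (seq (k * wseq)).
Notation value := (@value k d X).
Implicit Types (u v w : wseq) (s t b g : elt) (B C : seq elt).

Lemma value_cons c w t : value ((c, w) :: t) = c *: mon k w + value t.
Proof. exact: big_cons. Qed.

Lemma value_cat s t : value (s ++ t) = value s + value t.
Proof. exact: big_cat. Qed.

Lemma value_nil : value [::] = 0.
Proof. exact: big_nil. Qed.

Lemma wordof_eq u v : (wordof u == wordof v :> word X) = perm_eq u v.
Proof.
apply/cmP/idP => [uv|/permP uv l]; last by rewrite !wordof_count uv.
by apply/allP => l _; rewrite /= -!wordof_count uv.
Qed.

(** A formal combination may list a word several times and with its letters in any order, hence the
    sum over all permutations of [w]. *)
Definition coef w t : k :=
  foldr (fun (cv : k * wseq) a => if perm_eq cv.2 w then cv.1 + a else a) 0 t.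

Lemma coefE w t : coef w t = (value t)@_(wordof w).
Proof.
elim: t => [|[c v] t IH]; first by rewrite value_nil mcoeff0.
rewrite value_cons (mcoeff_lin _ c (mon k v) (value t)) -IH /= -wordof_eq.
rewrite monE mcoeffU1.
by case: (_ == _); rewrite ?mulr1 ?mulr0 ?add0r.
Qed.

Lemma msupp_value t (x : word X) : x \in msupp (value t) ->
  exists2 cv, cv \in t & x = wordof cv.2.
Proof.
have [w ->] := wordof_onto x.
rewrite -mcoeff_neq0 -coefE; elim: t => [|[c v] t IH] /=; first by rewrite eqxx.
case: ifP => [|_ /IH [cv cvt wE]].
  by rewrite -wordof_eq => /eqP <-; exists (c, v); rewrite ?mem_head.
by exists cv; rewrite // in_cons cvt orbT.
Qed.

Definition scale (c : k) t : elt := [seq (c * cw.1, cw.2) | cw <- t].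

Lemma value_scale c t : value (scale c t) = c *: value t.
Proof.
elim: t => [|[a w] t IH]; first by rewrite value_nil scaler0.
by rewrite [scale _ _]/= !value_cons IH scalerDr scalerA.
Qed.

(* Any word in which t has a nonzero coefficient, unless t represents 0. *)
Definition pivot t : wseq :=
  foldr (fun (cv : k * wseq) v => if coef cv.2 t == 0 then v else cv.2) [::] t.

(** A word in the support of [value t] is listed in [t], so the search for a pivot can only fail
    when all coefficients vanish. *)
Lemma pivot_eq0 t : (coef (pivot t) t == 0) = (value t == 0).
Proof.
apply/idP/eqP => [t0|t0]; last by rewrite coefE t0 mcoeff0.
have sub s : coef (foldr (fun (cv : k * wseq) v =>
      if coef cv.2 t == 0 then v else cv.2) [::] s) t == 0 ->
    forall cv, cv \in s -> coef cv.2 t == 0.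
  elim: s => //= cv s IH; case: ifP => [cv0 /IH h|->] // cv'.
  by rewrite in_cons => /predU1P [-> //|/h].
apply/malgP => x; rewrite mcoeff0; have [w ->] := wordof_onto x.
apply/eqP; apply: contraT => /[dup] wn; rewrite mcoeff_neq0.
by case/msupp_value => cv cvt wE; move: wn; rewrite wE -coefE (sub t).
Qed.

(** One elimination step, cancelling the pivot of [b] in [g]. If [b] represents 0, the divisor is 0,
    the quotient is 0 by convention, and the value of [g] is unchanged. *)
Definition red b g : elt :=
  g ++ scale (- (coef (pivot b) g / coef (pivot b) b)) b.

Definition reduce g B : elt := foldr red g B.

Definition basis C : seq elt := foldr (fun f B => reduce f B :: B) [::] C.

Definition inspan C g : bool :=
  let r := reduce g (basis C) in coef (pivot r) r == 0.

Lemma red_self b g : value g = value b -> value (red b g) = 0.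
Proof.
move=> gb; rewrite value_cat value_scale !coefE gb -coefE.
have [b0|b0] := eqVneq (coef (pivot b) b) 0.
  have /eqP -> : value b == 0 by rewrite -pivot_eq0 b0.
  by rewrite scaler0 addr0.
by rewrite divff // scaleN1r subrr.
Qed.

(** Linearity is stated on values because different lists represent the same element. *)
Let lin (F : elt -> elt) := forall c s t g,
  value g = c *: value s + value t ->
  value (F g) = c *: value (F s) + value (F t).

Let lin0 F g : lin F -> value g = 0 -> value (F g) = 0.
Proof.
move=> lF g0; have := lF (- 1) g g g.
by rewrite scaleN1r addNr scaleN1r addNr; apply.
Qed.

Let lin_red b : lin (red b).
Proof.
move=> c s t g gE; rewrite !value_cat !value_scale !coefE gE.
rewrite (mcoeff_lin (wordof (pivot b)) c (value s) (value t)).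
exact: elimination_lin.
Qed.

Let lin_reduce B : lin (reduce^~ B).
Proof.
by elim: B => [|b B IH] c s t g gE //=; apply: lin_red; apply: IH.
Qed.

Definition inC C := lspan (fun f : kalg k X => exists2 g, g \in C & f = value g).

(** Together with [lin_reduce], this identifies the kernel of the reduction, as a map on values,
    with the span of [C]. A new [f] enters as its own reduction [b], and the step [red b] then sends
    that to 0 by [red_self]. *)
Lemma reduce_basis C :
  (forall s, s \in C -> value (reduce s (basis C)) = 0)
  /\ forall g, inC C (value g - value (reduce g (basis C))).
Proof.
elim: C => [|f C [IH0 IHC]].
  by split=> // g; rewrite subrr; apply: lspan0.
rewrite [basis _]/=; set R := reduce^~ (basis C); set b := reduce f (basis C).
have sub x : inC C x -> inC (f :: C) x.
  apply: lspan_sub; [exact: lspan0|exact: lspan_lin|].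
  move=> _ [g gC ->]; apply: lspan_gen; exists g => //.
  by rewrite in_cons gC orbT.
split=> [s|g].
  rewrite in_cons => /predU1P [->|/IH0 sC]; first exact: red_self.
  by apply: lin0 sC; apply: lin_red.
rewrite [reduce _ _]/= value_cat value_scale.
set c := coef _ _ / _; rewrite scaleNr opprD opprK addrA addrC.
apply: lspan_lin; last exact: sub.
(* [b] differs from [f] by an element of the span of [C]. *)
have -> : value b = - 1 *: (value f - value b) + value f.
  by rewrite scaleN1r opprB subrK.
apply: lspan_lin; first exact: sub.
by apply: lspan_gen; exists f => //; rewrite mem_head.
Qed.

Lemma inspanP C g : inspan C g <-> inC C (value g).
Proof.
have [ker im] := reduce_basis C; rewrite /inspan /= pivot_eq0; split=> [/eqP g0|].
  by have := im g; rewrite g0 subr0.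
have [x gx] : exists x, value g = x by exists (value g).
rewrite gx => Cx; elim: Cx g gx => {x} [|c x y [s sC ->] _ IH] g gE.
  by apply/eqP; apply: (@lin0 (reduce^~ (basis C))) gE; apply: lin_reduce.
(* Removing the first term from [g] gives a representative of the rest of the combination, to which
   the induction hypothesis applies. *)
have gy : value (g ++ scale (- c) s) = y.
  by rewrite value_cat value_scale gE scaleNr addrAC subrr add0r.
apply/eqP; rewrite (@lin_reduce (basis C) c s (g ++ scale (- c) s)); last first.
  by rewrite gy.
by rewrite (eqP (IH _ gy)) ker // scaler0 addr0.
Qed.

End Algorithm.

(** * Computability of the elimination *)

Section ComputableReduction.
Context (k : fieldType) (d : Order.disp_t) (X : orderType d).

Notation den := (den k X).
Notation wseq := (seq (X * nat)).
Notation elt := (seq (k * wseq)).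
Notation tTerm := (tProd tScal tWord).

Lemma cpt_app2 A B C E (g : den B -> den C -> den E) (b : den A -> den B)
    (c : den A -> den C) :
  cpt (A := tProd B C) (fun p => g p.1 p.2) -> cpt b -> cpt c ->
  cpt (fun x => g (b x) (c x)).
Proof.
move=> cg cb cc.
by refine (cpt_comp (B := tProd B C) (f := fun x => (b x, c x)) cg _); apply: cpt_pair.
Qed.

Lemma cpt_coef A (w : den A -> den tWord) (t : den A -> den tElt) :
  cpt w -> cpt t -> cpt (B := tScal) (fun x => coef (w x : wseq) (t x : elt)).
Proof.
apply: cpt_app2.
refine (cpt_foldr (A := tProd tWord tElt) (E := tTerm) (B := tScal)
  (g := fun p (cv : k * wseq) (a : k) => if perm_eq cv.2 p.1 then cv.1 + a else a)
  _ (cpt_const _ _) _); first by cpt_var.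
by apply: cpt_if; [apply: cpt_perm; cpt_var|apply: cpt_add; cpt_var|cpt_var].
Qed.

Lemma cpt_scale A (c : den A -> den tScal) (t : den A -> den tElt) :
  cpt c -> cpt t -> cpt (B := tElt) (fun x => scale (c x : k) (t x : elt)).
Proof.
apply: cpt_app2.
refine (cpt_map (A := tProd tScal tElt) (E := tTerm) (F := tTerm)
  (g := fun p (cw : k * wseq) => (p.1 * cw.1 : k, cw.2)) _ _); first by cpt_var.
by apply: cpt_pair; [apply: cpt_mul; cpt_var|cpt_var].
Qed.

Lemma cpt_pivot A (t : den A -> den tElt) :
  cpt t -> cpt (B := tWord) (fun x => pivot (t x : elt)).
Proof.
apply: cpt_comp.
refine (cpt_foldr (A := tElt) (E := tTerm) (B := tWord)
  (g := fun t (cv : k * wseq) (v : wseq) => if coef cv.2 t == 0 then v else cv.2)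
  (cpt_id _) (cpt_const _ _) _).
apply: cpt_if; try by cpt_var.
by apply: cpt_eqs; [apply: cpt_coef|]; cpt_var.
Qed.

Lemma cpt_red A (b g : den A -> den tElt) :
  cpt b -> cpt g -> cpt (B := tElt) (fun x => red (b x : elt) (g x)).
Proof.
move=> cb cg; apply: (cpt_cat cg); refine (cpt_scale _ cb); apply: cpt_opp.
apply: cpt_mul; last apply: cpt_inv; apply: cpt_coef => //; exact: cpt_pivot cb.
Qed.

Lemma cpt_reduce A (g : den A -> den tElt) (B : den A -> den (tList tElt)) :
  cpt g -> cpt B -> cpt (B := tElt) (fun x => reduce (g x : elt) (B x)).
Proof.
move=> cg cB; refine (cpt_foldr (E := tElt) (B := tElt)
  (g := fun _ (b g : elt) => red b g) cB cg _).
by apply: cpt_red; cpt_var.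
Qed.

Lemma cpt_inspan A (C : den A -> den (tList tElt)) (g : den A -> den tElt) :
  cpt C -> cpt g -> cpt (B := tBool) (fun x => inspan (C x) (g x : elt)).
Proof.
move=> cC cg.
have cr : cpt (B := tElt) (fun x => reduce (g x : elt) (basis (C x))).
  apply: cpt_reduce => //.
  refine (cpt_foldr (E := tElt) (B := tList tElt)
    (g := fun _ (f : elt) B => reduce f B :: B) cC (cpt_const _ _) _).
  by apply: cpt_cons; [apply: cpt_reduce|]; cpt_var.
by apply: cpt_eqs (cpt_const _ _); apply: cpt_coef => //; apply: cpt_pivot.
Qed.

End ComputableReduction.

(** * Enumeration of generators and the decision procedure *)

Section Decision.
Context (k : fieldType) (d : Order.disp_t) (X : orderType d).

Notation den := (den k X).
Notation wseq := (seq (X * nat)).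
Notation elt := (seq (k * wseq)).
Notation value := (@value k d X).
Notation tLet := (tProd tGen tNat).
Notation tTerm := (tProd tScal tWord).
Implicit Types (w : wseq) (s t : elt) (C : seq elt) (L : wseq) (Y : seq X).
Implicit Types (S : {fset kalg k X}).

(** A fold does not see the tail of the list, so the word itself is rebuilt beside the list of terms
    of its derivative. *)
Definition derw_rec w : wseq * seq wseq :=
  foldr (fun (l : X * nat) (p : wseq * seq wseq) =>
    (l :: p.1, ((l.1, l.2.+1) :: p.1) :: [seq l :: v | v <- p.2])) ([::], [::]) w.

Definition derw w : seq wseq := (derw_rec w).2.

Lemma derw_cons l w :
  derw (l :: w) = ((l.1, l.2.+1) :: w) :: [seq l :: v | v <- derw w].
Proof.
rewrite {1}/derw /=; congr ((_ :: _) :: _).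
by elim: w => //= m w ->.
Qed.

Definition der t : elt := flatten [seq [seq (cw.1, v) | v <- derw cw.2] | cw <- t].

Lemma value_const c (ws : seq wseq) :
  value [seq (c, v) | v <- ws] = c *: \sum_(v <- ws) mon k v.
Proof.
elim: ws => [|w ws IH]; first by rewrite value_nil big_nil scaler0.
by rewrite /= value_cons big_cons IH scalerDr.
Qed.

Lemma D_mon w : D (mon k w) = \sum_(v <- derw w) mon k v.
Proof.
elim: w => [|[a n] w IH]; first by rewrite /mon big_nil D1 big_nil.
rewrite (mon_cons k (a, n) w) D_Leibniz D_letter IH derw_cons big_cons.
rewrite (mon_cons k (a, n.+1) w) [X in _ + X]mulr_sumr big_map; congr (_ + _).
by apply: eq_bigr => v _; rewrite (mon_cons k (a, n) v).
Qed.

Lemma value_der t : value (der t) = D (value t).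
Proof.
elim: t => [|[c w] t IH]; first by rewrite value_nil D0.
by rewrite value_cons DZD D_mon -IH -value_const -value_cat.
Qed.

Definition letmul (l : X * nat) t : elt := [seq (cw.1, l :: cw.2) | cw <- t].

Lemma value_letmul l t : value (letmul l t) = letterU k l * value t.
Proof.
elim: t => [|[c w] t IH]; first by rewrite value_nil mulr0.
rewrite [letmul _ _]/= !value_cons IH mulrDr (mon_cons k l w); congr (_ + _).
exact: scalerAr.
Qed.

(** The old list is kept, so surplus rounds lose nothing. *)
Definition expand L C : seq elt :=
  C ++ [seq der t | t <- C] ++ flatten [seq [seq letmul l t | t <- C] | l <- L].

Lemma mem_expand L C t : t \in C -> t \in expand L C.
Proof. by move=> tC; rewrite mem_cat tC. Qed.

Lemma mem_expand_der L C t : t \in C -> der t \in expand L C.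
Proof. by move=> tC; rewrite !mem_cat map_f ?orbT. Qed.

Lemma mem_expand_letmul L C l t : t \in C -> l \in L -> letmul l t \in expand L C.
Proof.
move=> tC lL; rewrite !mem_cat; apply/orP; right; apply/orP; right.
by apply/flatten_mapP; exists l => //; apply: map_f.
Qed.

Lemma expand_dideal S L C :
  (forall t, t \in C -> dideal S (value t)) ->
  forall t, t \in expand L C -> dideal S (value t).
Proof.
move=> SC t; rewrite !mem_cat => /or3P [/SC //|/mapP [u /SC Su ->]|].
  by rewrite value_der; apply: dideal_D.
case/flatten_mapP => l lL /mapP [u /SC Su ->].
by rewrite value_letmul; apply: dideal_mul.
Qed.

Lemma iter_expand_dideal S L C n :
  (forall t, t \in C -> dideal S (value t)) ->
  forall t, t \in iter n (expand L) C -> dideal S (value t).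
Proof. by move=> SC; elim: n => //= n IH; apply: expand_dideal. Qed.

(** [m] rounds serve for the derivatives and one more for each letter of [w]; the remaining rounds
    only preserve membership. *)
Lemma mem_iter_expand L C w n m s :
  s \in C -> {subset w <= L} -> (m + size w <= n)%N ->
  exists2 t, t \in iter n (expand L) C & value t = mon k w * iter m (@D k X) (value s).
Proof.
move=> sC wL mn; rewrite -(subnK mn) iterD; set q := (n - _)%N.
suff [t tC <-] : exists2 t, t \in iter (m + size w) (expand L) C &
    value t = mon k w * iter m (@D k X) (value s).
  by exists t => //; elim: q => //= q IH; apply: mem_expand.
elim: w wL {mn q} => [|l w IH] wL.
  rewrite addn0 [mon k _]big_nil; set x := iter m _ (value s).
  suff [t tC tE] : exists2 t, t \in iter m (expand L) C & value t = x.
    by exists t; rewrite // mul1r.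
  rewrite /x {x}; elim: m => [|m [t tC tE]]; first by exists s.
  by exists (der t); [exact: mem_expand_der|rewrite value_der tE].
have [|t tC tE] := IH; first by move=> x xw; apply: wL; rewrite in_cons xw orbT.
exists (letmul l t).
  by rewrite addnS; apply: mem_expand_letmul => //; apply: wL; apply: mem_head.
rewrite value_letmul tE (mon_cons k l w).
exact: (mulrA (letterU k l) (mon k w) (iter m (@D k X) (value s))).
Qed.

(** With the shift of indices, these are the letters a[-1], ..., a[n-2]. *)
Definition lets (a : X) (n : nat) : wseq :=
  nat_rect (fun _ => wseq) [::] (fun m r => (a, m) :: r) n.

Lemma mem_lets a n b i : ((b, i) \in lets a n) = (b == a) && (i < n)%N.
Proof.
elim: n => [|n IH] /=; first by rewrite ltn0 andbF.
by rewrite in_cons IH ltnS [(i <= n)%N]leq_eqVlt andb_orr xpair_eqE.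
Qed.

Definition letters Y n : wseq := flatten [seq lets a n | a <- Y].

Lemma mem_letters Y n l : l.1 \in Y -> (l.2 < n)%N -> l \in letters Y n.
Proof.
case: l => a i /= aY i_n; apply/flatten_mapP; exists a => //.
by rewrite mem_lets eqxx.
Qed.

Definition vgens t : seq X := flatten [seq [seq l.1 | l <- cw.2] | cw <- t].

(** A crude bound for the length of every word listed in [t]. *)
Definition nletters t : nat := foldr (fun (cw : k * wseq) n => size cw.2 + n)%N 0%N t.

Lemma size_nletters t cw : cw \in t -> (size cw.2 <= nletters t)%N.
Proof.
elim: t => //= cv t IH; rewrite in_cons => /predU1P [->|/IH h].
  exact: leq_addr.
exact: leq_trans h (leq_addl _ _).
Qed.

(** With N = [nletters t], a product of [r] and D^n(s) of weight -1 and length at most N has n <= N,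
    at most N letters in [r], and second components at most N in [r]. Hence N + N rounds and second
    components below N + 1. *)
Definition decide C Y t : bool :=
  inspan (iter (nletters t + nletters t) (expand (letters (Y ++ vgens t) (nletters t).+1)) C) t.

(** * Computability of the decision procedure *)

Lemma cpt_size A E (s : den A -> den (tList E)) :
  cpt s -> cpt (B := tNat) (fun x => size (s x)).
Proof.
move=> cs; refine (cpt_foldr (E := E) (B := tNat) (g := fun _ _ => S) cs (cpt_const _ _) _).
by apply: cpt_succ; cpt_var.
Qed.

Lemma cpt_expand A (L : den A -> den tWord) (C : den A -> den (tList tElt)) :
  cpt L -> cpt C -> cpt (B := tList tElt) (fun x => expand (L x) (C x)).
Proof.
have cderw : cpt (k := k) (A := tWord) (B := tList tWord) derw.
  refine (cpt_snd (A := tWord) (B := tWord) (C := tList tWord) (f := derw_rec) _).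
  refine (cpt_foldr (A := tWord) (E := tLet) (B := tProd tWord (tList tWord))
    (g := fun _ (l : X * nat) (p : wseq * seq wseq) =>
      (l :: p.1, ((l.1, l.2.+1) :: p.1) :: [seq l :: v | v <- p.2]))
    (cpt_id _) (cpt_const _ _) _).
  apply: cpt_pair; first by apply: cpt_cons; cpt_var.
  apply: cpt_cons.
    apply: cpt_cons; last by cpt_var.
    by apply: cpt_pair; [|apply: cpt_succ]; cpt_var.
  refine (cpt_map (A := tProd tWord (tProd tLet (tProd tWord (tList tWord))))
    (E := tWord) (F := tWord) (g := fun p (v : wseq) => p.2.1 :: v) _ _); first by cpt_var.
  by apply: cpt_cons; cpt_var.
have cder : cpt (A := tElt) (B := tElt) der.
  refine (cpt_flatmap (A := tElt) (E := tTerm) (F := tTerm)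
    (g := fun _ (cw : k * wseq) => [seq (cw.1, v) | v <- derw cw.2]) (cpt_id _) _).
  refine (cpt_map (A := tProd tElt tTerm) (E := tWord) (F := tTerm)
    (g := fun p (v : wseq) => (p.2.1, v)) _ _); last by apply: cpt_pair; cpt_var.
  by refine (cpt_comp (A := tProd tElt tTerm) (B := tWord) cderw _); cpt_var.
move=> cL cC; apply: (cpt_cat cC); apply: cpt_cat.
  refine (cpt_map (E := tElt) (F := tElt) (g := fun _ => der) cC _).
  by refine (cpt_comp (A := tProd A tElt) (B := tElt) cder _); cpt_var.
refine (cpt_flatmap (E := tLet) (F := tElt)
  (g := fun x l => [seq letmul l t | t <- C x]) cL _).
refine (cpt_map (A := tProd A tLet) (E := tElt) (F := tElt)
  (g := fun p => letmul p.2) _ _).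
  by refine (cpt_comp (A := tProd A tLet) cC _); cpt_var.
refine (cpt_map (A := tProd (tProd A tLet) tElt) (E := tTerm) (F := tTerm)
  (g := fun p (cw : k * wseq) => (cw.1, p.1.2 :: cw.2)) _ _); first by cpt_var.
by apply: cpt_pair; [|apply: cpt_cons]; cpt_var.
Qed.

(** [C] and [Y] are constants of the program; its only input is the combination to be tested. *)
Lemma cpt_decide C Y : cpt (A := tElt) (B := tBool) (decide C Y).
Proof.
have cN : cpt (A := tElt) (B := tNat) nletters.
  refine (cpt_foldr (A := tElt) (E := tTerm) (B := tNat)
    (g := fun _ (cw : k * wseq) n => size cw.2 + n)%N (cpt_id _) (cpt_const _ _) _).
  apply: cpt_addn; last by cpt_var.
  by refine (cpt_size (A := tProd tElt (tProd tTerm tNat)) (E := tLet) _); cpt_var.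
refine (cpt_inspan (A := tElt) _ (cpt_id _)).
refine (cpt_iter (A := tElt) (B := tList tElt)
  (g := fun t => expand (letters (Y ++ vgens t) (nletters t).+1))
  (cpt_addn cN cN) (cpt_const _ _) _).
apply: cpt_expand; last by cpt_var.
refine (cpt_comp (A := tProd tElt (tList tElt)) (B := tElt) (C := tWord)
  (g := fun t : elt => letters (Y ++ vgens t) (nletters t).+1) _ _); last by cpt_var.
refine (cpt_flatmap (A := tElt) (E := tGen) (F := tLet)
  (g := fun (t : elt) a => lets a (nletters t).+1) _ _).
  apply: cpt_cat; first exact: cpt_const.
  refine (cpt_flatmap (A := tElt) (E := tTerm) (F := tGen)
    (g := fun _ (cw : k * wseq) => [seq l.1 | l <- cw.2]) (cpt_id _) _).
  refine (cpt_map (A := tProd tElt tTerm) (E := tLet) (F := tGen)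
    (g := fun _ (l : X * nat) => l.1) _ _); by cpt_var.
refine (cpt_nrec (A := tProd tElt tGen) (B := tWord)
  (g := fun p m (r : wseq) => (p.2, m) :: r) _ (cpt_const _ _) _).
  apply: cpt_succ.
  by refine (cpt_comp (A := tProd tElt tGen) (B := tElt) cN _); cpt_var.
by apply: cpt_cons; [apply: cpt_pair|]; cpt_var.
Qed.

(** * Correctness of the decision procedure *)

Lemma sum_wt (w : seq (letter X)) :
  \sum_(l <- w) (l.2%:Z - 1) = (\sum_(l <- w) l.2)%N%:Z - (size w)%:Z.
Proof.
elim: w => [|l w IH]; first by rewrite !big_nil.
by rewrite !big_cons IH /=; clear; lia.
Qed.

(** Soundness holds because [expand] stays inside the differential ideal. Completeness is a
    projection onto the words that [t] can involve, whose generators have all been enumerated. *)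
Lemma decideP S C Y t :
  (forall s : kalg k X, s \in S -> exists2 u, u \in C & value u = s) ->
  (forall u, u \in C -> value u \in S) ->
  (forall s : kalg k X, s \in S -> {subset gens s <= Y}) ->
  (forall s : kalg k X, s \in S -> s \in GDN k X) -> (forall s : kalg k X, s \in S -> homogeneous s) ->
  value t \in GDN k X -> decide C Y t <-> dideal S (value t).
Proof.
move=> SC CS SY SG SH Gt; rewrite /decide inspanP.
set N := nletters t; set Z := Y ++ vgens t; set C' := iter _ _ _.
split.
  apply: lspan_sub; [exact: lspan0|exact: lspan_lin|].
  move=> _ [g gC ->]; move: gC; apply: iter_expand_dideal => u /CS.
  exact: dideal_base.
pose Q (x : word X) := [&& wt x == -1, (mdeg x <= N)%N & all (fun l => l.1 \in Z) (finsupp x)].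
move=> St; apply: (@dideal_proj _ _ S Q) St _; [exact: lspan0|exact: lspan_lin| |]; last first.
  move=> x xt; apply/and3P; have [cw cwt xE] := msupp_value xt.
  split; first by rewrite (GDNP _ Gt x xt).
    by rewrite xE mdeg_wordof size_nletters.
  apply/allP => l; rewrite xE mem_wordof => lw.
  rewrite mem_cat; apply/orP; right.
  by apply/flatten_mapP; exists cw => //; apply: map_f.
move=> r n s sS.
have [m hs] : exists m, hom (-1) m Z s.
  apply: hom_gens (SG _ sS) (SH _ sS) _ => a /(SY _ sS) aY.
  by rewrite mem_cat aY.
exists [&& \sum_(l <- r) (l.2%:Z - 1) == - n%:Z, (size r + m <= N)%N
         & all (fun l => l.1 \in Z) r].
  case/and3P => /eqP wr rm rZ.
  (* In shifted indices the weight condition becomes an equality of natural numbers, bounding [n]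
     and each second component by [size r]. *)
  have {wr} wr : ((\sum_(l <- r) l.2)%N + n = size r)%N.
    by move: wr; rewrite sum_wt; clear; lia.
  have rN : (size r <= N)%N := leq_trans (leq_addr _ _) rm.
  have [u uC us] := SC _ sS.
  have [||g gC gE] := @mem_iter_expand (letters Z N.+1) C r (N + N) n u uC.
  - move=> l lr; apply: mem_letters; first exact: (allP rZ).
    rewrite ltnS; apply: leq_trans rN; rewrite -wr (big_rem l) //=.
    by rewrite -addnA leq_addr.
  - by apply: leq_add => //; apply: leq_trans rN; rewrite -wr leq_addl.
  rewrite us in gE; apply: lspan_gen.
  by exists g; [exact: gC|exact: (esym gE)].
move=> x /(msupp_mon_iterD hs) [[xw xm xZ] rx].
rewrite /Q xw xm; congr [&& _, _ & _].
  by rewrite addrCA -[X in _ == X]addr0 (inj_eq (addrI _)) addr_eq0.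
(* Letters outside [r] come from D^n(s), hence lie over [Z] in any case. *)
apply/allP/allP => h l lx; first by apply: h; apply: rx.
by have [/h //|/(xZ l lx)] := boolP (l \in r).
Qed.

Lemma value_onto (f : kalg k X) : exists t, value t = f.
Proof.
elim/mon_ind: f => [|c f g [s <-] [t <-]|r].
- by exists [::]; rewrite value_nil.
- by exists (scale c s ++ t); rewrite value_cat value_scale.
- by exists [:: (1, r)]; rewrite value_cons value_nil addr0 scale1r.
Qed.

End Decision.

(** * Decidability of membership in Id(S) *)

Theorem proposition4p2 (k : fieldType) (d : Order.disp_t) (X : orderType d)
    (k_char0 : [pchar k] =i pred0)
    (X_wo : well_founded (fun a b : X => (a < b)%O))
    (S : {fset kalg k X})
    (S_GDN : forall s, s \in S -> s \in GDN k X)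
    (S_neq0 : S != fset0)
    (S_hom : forall s, s \in S -> homogeneous s) :
  solvable_word_problem S.
Proof.
(* Chosen representatives [C] of the elements of [S], and the list [Y] of the generators occurring
   in [S], are the data written into the program. *)
have [C CS] : exists C : seq (seq (k * seq (X * nat))), map (@value k d X) C = S.
  elim: (enum_fset S) => [|s r [C <-]]; first by exists [::].
  by have [t <-] := value_onto s; exists (t :: C).
have CP s : s \in S -> exists2 u, u \in C & value u = s.
  by rewrite -[s \in S]/(s \in enum_fset S) -CS => /mapP [u uC ->]; exists u.
have SC u : u \in C -> value u \in S.
  by move=> uC; rewrite -[_ \in S]/(_ \in enum_fset S) -CS map_f.
pose Y := flatten [seq gens s | s <- enum_fset S].
have SY (s : kalg k X) : s \in S -> {subset gens s <= Y}.
  by move=> sS a as_; apply/flatten_mapP; exists s.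
have [p pP] := cpt_decide C Y.
exists p => f Gf t tf; exists (decide C Y t); split; first exact: pP.
rewrite Id_iff_dideal // -tf; apply: decideP => //.
by rewrite tf.
Qed.
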